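(* Let $0<\varepsilon<1$, fix an instance, an optimal schedule $\mathrm{OPT}$ for the total flow time objective, and a time $t$. Let $t_0\le t$ be such that $$\mathrm{vol}_{B(t_0)}(t_0)\ge \mathrm{vol}^*_{\mathrm{OPT}(t,t_0)}(t_0)\qquad\text{and}\qquad U(t_0)=F(t_0),$$ i.e., all unknown jobs at $t_0$ are frozen. Let $t_1\ge t_0$ (with $t_1\le t$) be such that: 1. at time $t_1$, the leader $L(t_1)\in U(t_1)\setminus F(t_1)$ with $e_{L(t_1)}(t_1)=\max_{j\in U(t_1)\setminus F(t_1)}e_j(t_1)$ is touched by SLF; 2. the set of frozen jobs does not change during $[t_0,t_1]$, that is, $F(t_0)=F(t')$ for all $t'\in[t_0,t_1]$; and 3. during $(t_0,t_1]$, there is always at least one new unknown job, that is, $|U(s)\setminus U(t_0)|\ge 1$ for all $s\in(t_0,t_1]$. (This implies that there is a new job arrival during $(t_0,t_1]$.) Then $\mathrm{vol}_{B(t_1)}(t_1)\ge\mathrm{vol}^*_{\mathrm{OPT}(t,t_1)}(t_1)$.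
   Context: **Problem.** An instance is a finite set of jobs. Job $j$ has a release (arrival) time $\ge 0$ and a processing time $p_j>0$. A single machine of unit speed processes the jobs; preemption is allowed at no cost, and the machine may be time-shared (job rates are nonnegative and sum to at most $1$). A job may only be processed after its release and completes when it has received $p_j$ units of processing. A job is active at time $s$ in a schedule if it has been released and is not finished at time $s$. The flow time of a job is its completion time minus its release time; an optimal schedule (computed offline) minimizes the sum of the flow times of all jobs. **Algorithm SLF (Shortest Lower-Bound First).** At time $s$, in the schedule of SLF, let $e_j(s)$ be the amount of processing job $j$ has received up to time $s$ and $r_j(s)=p_j-e_j(s)$ its remaining processing time. An active job $j$ is *known* at time $s$ if $r_j(s)\le \varepsilon p_j$ and *unknown* otherwise; $K(s)$ and $U(s)$ denote the sets of known and unknown active jobs. The estimate of an active job is $\eta_j(s)=\frac{\varepsilon}{1-\varepsilon}e_j(s)$ if $j\in U(s)$ and $\eta_j(s)=r_j(s)$ if $j\in K(s)$. At each time $s$ with at least one active job, SLF does the following, where a minimum over the empty set is $+\infty$: 1. If $\min_{j\in K(s)}\eta_j(s)\le\min_{j\in U(s)}\eta_j(s)$, it processes an arbitrary known job with minimum $\eta_j(s)$. 2. Otherwise, it processes all unknown jobs with minimum $\eta_j(s)$ in parallel at an equal rate (Round-Robin with infinitesimally small steps). A job is *touched* at time $s$ if it is among the jobs SLF processes at time $s$. **Standing assumptions.** SLF does not idle until time $t$, and neither SLF nor the optimal schedule idles unnecessarily (while there are active jobs). **Notation.** $\mathrm{SLF}(s)$ and $\mathrm{OPT}(s)$ are the sets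 of jobs active at time $s$ in SLF's and in the optimal schedule; for $s\le t$, $\mathrm{OPT}(t,s)=\mathrm{OPT}(t)\cap\mathrm{OPT}(s)$. $r^*_j(s)$ is the remaining processing time of $j$ at time $s$ in the optimal schedule; for a set $Q$ of jobs, $\mathrm{vol}_Q(s)=\sum_{j\in Q}r_j(s)$ and $\mathrm{vol}^*_Q(s)=\sum_{j\in Q}r^*_j(s)$. $B(s)$ is the set of the $\lceil 1/\varepsilon\rceil\cdot|\mathrm{OPT}(t,s)|$ jobs of $\mathrm{SLF}(s)$ with largest remaining processing time $r_j(s)$ (all of $\mathrm{SLF}(s)$ if there are fewer). **Frozen jobs and leader (relative to the fixed time $t$).** For $s\le t$, a job $j$ is *frozen* at time $s$ if it is unknown at time $s$ and not touched by SLF during $[s,t]$; $F(s)$ is the set of jobs frozen at time $s$. If $|U(s)\setminus F(s)|\ge 1$, the *leader* $L(s)$ is some job in $U(s)\setminus F(s)$ with $e_{L(s)}(s)=\max_{j\in U(s)\setminus F(s)}e_j(s)$. *)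

(* Defs.v *)
From HB Require Import structures.
From mathcomp Require Import all_boot all_order all_algebra.
From mathcomp Require Import all_classical all_reals all_analysis.

Set Implicit Arguments.
Unset Strict Implicit.
Unset Printing Implicit Defensive.

Import Order.TTheory GRing.Theory Num.Theory.

Local Open Scope ring_scope.

Record instance (R : realType) := Instance {
  job : finType;
  release : job -> R;
  proc : job -> R;
  release_ge0 : forall j, 0 <= release j;
  proc_gt0 : forall j, 0 < proc j }.

Definition processed (R : realType) (I : instance R) (x : job I -> R -> R)
    (j : job I) (s : R) : R :=
  (\int[lebesgue_measure]_(u in `[0, s]) x j u)%R.

Definition remaining (R : realType) (I : instance R) (x : job I -> R -> R)
    (j : job I) (s : R) : R :=
  proc j - processed x j s.

Record schedule (R : realType) (I : instance R) := Schedule {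
  rate :> job I -> R -> R;
  rate_measurable : forall j, measurable_fun [set: R]%classic (rate j);
  rate_ge0 : forall j s, 0 <= rate j s;
  rate_sum_le1 : forall s, \sum_j rate j s <= 1;
  rate_gt0 : forall j s, 0 < rate j s ->
    release j <= s /\ 0 < remaining rate j s }.

Section Schedules.
Variables (R : realType) (I : instance R).
Implicit Types (x : schedule I) (j : job I) (s : R) (A Q : {set job I}).

(* The state at time s is the state just before the arrivals at time s: a job
   counts as released at s once its release time lies strictly before s.  If it
   were already active at the instant of its release, a new unknown job could
   not be present at every time of an interval ]t0, t1] without belonging to the
   state at t0 (there are finitely many jobs). *)
Definition active x s : {set job I} :=
  [set j | (release j < s) && (0 < remaining x j s)].

Definition available x s : {set job I} :=
  [set j | (release j <= s) && (0 < remaining x j s)].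

Definition vol x Q s : R := \sum_(j in Q) remaining x j s.

(* +oo when the job is never completed *)
Definition completion x j : \bar R :=
  ereal_inf [set s%:E | s in [set s : R | 0 <= s /\ processed x j s = proc j]]%classic.

Definition total_flow x : \bar R :=
  (\sum_j (completion x j - (release j)%:E))%E.

Definition optimal x : Prop := forall y, (total_flow x <= total_flow y)%E.

Definition busy_until x t : Prop :=
  \forall s \ae (@lebesgue_measure R), 0 <= s < t -> \sum_j x j s = 1.

Definition no_unnecessary_idling x : Prop :=
  \forall s \ae (@lebesgue_measure R), active x s != finset.set0 -> \sum_j x j s = 1.

Variable eps : R.

Definition known x s j : bool := remaining x j s <= eps * proc j.

Definition unknown_set x s : {set job I} :=
  [set j in active x s | ~~ known x s j].

Definition estimate x s j : R :=
  if known x s j then remaining x j s else eps / (1 - eps) * processed x j s.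

Definition min_estimate x s Q : \bar R :=
  \big[mine/+oo%E]_(j in Q) (estimate x s j)%:E.

Definition slf_step x s A : Prop :=
  let K := [set j in A | known x s j] in
  let U := [set j in A | ~~ known x s j] in
  if (min_estimate x s K <= min_estimate x s U)%E then
    exists j, [/\ j \in K, (estimate x s j)%:E = min_estimate x s K
                & forall i, x i s = (i == j)%:R]
  else
    let M := [set j in U | (estimate x s j)%:E == min_estimate x s U] in
    forall i, x i s = if i \in M then #|M|%:R^-1 else 0.

(* Whether the decision made at the very instant s takes into account the jobs
   released exactly at s is left open; this affects only finitely many times. *)
Definition is_slf x : Prop :=
  forall s, 0 <= s ->
    exists A : {set job I}, [/\ active x s \subset A, A \subset available x s
      & A != finset.set0 -> slf_step x s A].

Definition touched x s j : Prop := 0 < x j s.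

Definition frozen_set x t s : {set job I} :=
  [set j in unknown_set x s | `[< forall u, s <= u <= t -> ~ touched x u j >]].

Definition is_leader x t s j : Prop :=
  j \in unknown_set x s :\: frozen_set x t s /\
  forall i, i \in unknown_set x s :\: frozen_set x t s ->
    processed x i s <= processed x j s.

(* Q consists of the k jobs of A with largest remaining processing time at s
   (ties broken arbitrarily), and of all of A if A has fewer than k jobs. *)
Definition k_largest x s (k : nat) A Q : Prop :=
  [/\ Q \subset A, #|Q| = minn k #|A|
    & forall i j, i \in Q -> j \in A :\: Q -> remaining x j s <= remaining x i s].

Definition opt_alive opt t s : {set job I} := active opt t :&: active opt s.

Definition is_B (slf opt : schedule I) t s Q : Prop :=
  k_largest slf s (`|Num.ceil (1 / eps)|%N * #|opt_alive opt t s|)%N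
    (active slf s) Q.

End Schedules.

(* Main.v *)
Require Import Defs.
From HB Require Import structures.
From mathcomp Require Import all_boot all_order all_algebra.
From mathcomp Require Import all_classical all_reals all_analysis.
From mathcomp Require Import ring lra.

(* Let E be the amount of processing that the leader L has received at t1 and
   th = eps / (1 - eps) * E its estimate.  When a new job stops being unknown it
   is being processed, so the new job that remains unknown at that moment has
   received at least as much; hence the maximal amount received by a new unknown
   job never decreases, and it is bounded by E on (t0, t1].  It follows that new
   jobs known at t1 have p_j <= E / (1 - eps), and that a job known at t0 is
   processed in (t0, t1] only if its remaining time at t0 is at most th, while
   all jobs active at t1 have remaining time at least th.

   If B(t1) is all of SLF(t1), compare the total volumes, as neither schedule
   idles before t.  Otherwise, with c = ceil(1/eps), sum the excess r_j - th over
   B(t1): it dominates the excess over the jobs of B(t0) still active, plus the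
   excess over the new jobs of OPT(t,t1) still active in SLF, and c th >= E + th
   pays for one new job of OPT(t,t1). *)

Set Implicit Arguments.
Unset Strict Implicit.
Unset Printing Implicit Defensive.

Import Order.TTheory GRing.Theory Num.Theory.
Local Open Scope ring_scope.

(** * Processing received as a function of time, and total work *)

Section Processing.
Variables (R : realType) (I : instance R) (x : schedule I).
Implicit Types (j : job I) (a b s v : R).

Local Notation mu := (@lebesgue_measure R).

Lemma rate_le1 j s : rate x j s <= 1.
Proof.
apply: le_trans (rate_sum_le1 x s); rewrite (bigD1 j)//= lerDl.
by apply: sumr_ge0 => i _; exact: rate_ge0.
Qed.

Lemma rate_integrable j (i : interval R) : (mu [set` i]%classic < +oo)%E ->
  mu.-integrable [set` i]%classic (EFin \o rate x j).
Proof.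
move=> fin_i; apply: measurable_bounded_integrable => //.
  exact: measurable_funS (rate_measurable x j).
exists 1; split => // M M1 s _ /=; rewrite ger0_norm ?rate_ge0//.
exact: le_trans (rate_le1 j s) (ltW M1).
Qed.

Lemma itv_finite (u v : bool) a b :
  (mu [set` Interval (BSide u a) (BSide v b)]%classic < +oo)%E.
Proof. by rewrite lebesgue_measure_itv/=; case: ifP => // _; rewrite -EFinB ltry. Qed.

Lemma processedB j a b : 0 <= a -> a <= b ->
  processed x j b - processed x j a = (\int[mu]_(s in `]a, b]) x j s)%R.
Proof.
move=> a0 ab; rewrite /processed Rintegral_itvB ?bnd_simp//.
exact: rate_integrable (itv_finite _ _ _ _).
Qed.

Lemma processed_mono j a b : 0 <= a -> a <= b -> processed x j a <= processed x j b.
Proof.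
move=> a0 ab; rewrite -subr_ge0 processedB//.
by apply: Rintegral_ge0 => s _; exact: rate_ge0.
Qed.

Lemma processed_lip j a b : 0 <= a -> a <= b ->
  processed x j b - processed x j a <= b - a.
Proof.
move=> a0 ab; rewrite processedB//.
apply: (@le_trans _ _ (\int[mu]_(s in `]a, b]) 1)%R).
  apply: le_Rintegral => //.
  - exact: rate_integrable (itv_finite _ _ _ _).
  - apply: measurable_bounded_integrable => //; first exact: itv_finite.
    by exists 1; split => // M M1 s _ /=; rewrite normr1 ltW.
  - by move=> s _; exact: rate_le1.
rewrite Rintegral_cst//= lebesgue_measure_itv/= lte_fin.
by case: ltP => [_|ba]; rewrite /= mul1r// subr_ge0.
Qed.

Lemma processed_const j a b : 0 <= a -> a <= b ->
  (forall s, a < s < b -> x j s = 0) -> processed x j b = processed x j a.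
Proof.
move=> a0 ab x0; apply/eqP; rewrite -subr_eq0 processedB//.
rewrite -Rintegral_itv_bndo_bndc; last exact: rate_integrable (itv_finite _ _ _ _).
rewrite (@eq_Rintegral _ _ _ _ _ (cst 0)) ?Rintegral_cst ?mul0r//.
by move=> s; rewrite inE/= in_itv/= => /x0.
Qed.

(** Turns progress over an interval into an instant strictly inside it, where [rate_gt0] or the rule
    of SLF can be applied. *)
Lemma exists_rate_gt0 j a b : 0 <= a -> a <= b ->
  processed x j a < processed x j b -> exists2 s, a < s < b & 0 < x j s.
Proof.
move=> a0 ab lt_ab; apply: contrapT => none.
suff eq_ab : processed x j b = processed x j a by rewrite eq_ab ltxx in lt_ab.
apply: processed_const => // s sab; apply/eqP; rewrite eq_le rate_ge0 andbT leNgt.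
by apply/negP => xs; apply: none; exists s.
Qed.

Lemma processed0 j : processed x j 0 = 0.
Proof. by rewrite /processed set_itv1 Rintegral_set1. Qed.

Lemma processed_ge0 j s : 0 <= s -> 0 <= processed x j s.
Proof. by move=> s0; rewrite -(processed0 j) processed_mono. Qed.

Lemma processed_before_release j s : 0 <= s -> s <= release j -> processed x j s = 0.
Proof.
move=> s0 sr; rewrite -(processed0 j); apply: processed_const => // u /andP[_ us].
apply/eqP; rewrite eq_le rate_ge0 andbT leNgt; apply/negP => /rate_gt0[ru _].
by have := lt_le_trans us (le_trans sr ru); rewrite ltxx.
Qed.

(** [c] is the supremum of the times in [[a, b]] with processing below [v]. As processing grows at
    speed at most 1, its value at [c] can be neither above nor below [v]. *)
Lemma first_passage j a b v : 0 <= a -> a <= b ->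
  processed x j a < v -> v <= processed x j b ->
  exists c, [/\ a < c, c <= b, processed x j c = v &
                forall s, a <= s < c -> processed x j s < v].
Proof.
move=> a0 ab av vb.
pose A := [set s | a <= s <= b /\ processed x j s < v]%classic.
have Aa : A a by split => //; rewrite lexx.
have supA : has_sup A by split; [exists a|exists b => s [/andP[]]].
have cb : sup A <= b by apply: ge_sup; [exists a|move=> s [/andP[]]].
have ac : a <= sup A by apply: ub_le_sup => //; case: supA.
have below s : a <= s < sup A -> processed x j s < v.
  move=> /andP[as_ sc]; have /(sup_adherent)/(_ supA)[u Au] : 0 < sup A - s by lra.
  rewrite opprB addrC subrK => su; case: Au => _; apply: le_lt_trans.
  by apply: processed_mono => //; [exact: le_trans as_|exact: ltW].
have cv : processed x j (sup A) <= v.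
  rewrite leNgt; apply/negP => vc.
  have {ac}ac : a < sup A.
    by rewrite lt_neqAle ac andbT; apply/eqP => ac'; rewrite -ac' in vc; lra.
  pose s := Num.max a (sup A - (processed x j (sup A) - v)).
  have sc : s < sup A by rewrite /s gt_max ac/=; lra.
  have as_ : a <= s by rewrite /s le_max lexx.
  have hs : sup A - (processed x j (sup A) - v) <= s by rewrite /s le_max lexx orbT.
  have := below s; rewrite as_ sc => /(_ isT).
  have := processed_lip j (le_trans a0 as_) (ltW sc); lra.
have vc : v <= processed x j (sup A).
  rewrite leNgt; apply/negP => cv'.
  have {cb}cb : sup A < b.
    by rewrite lt_neqAle cb andbT; apply/eqP => cb'; rewrite cb' in cv'; lra.
  pose s := Num.min b (sup A + (v - processed x j (sup A)) / 2).
  have sc : sup A < s by rewrite /s lt_min cb/=; lra.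
  have sb : s <= b by rewrite /s ge_min lexx.
  have hs : s <= sup A + (v - processed x j (sup A)) / 2.
    by rewrite /s ge_min lexx orbT.
  have lip := processed_lip j (le_trans a0 ac) (ltW sc).
  have /(ub_le_sup (proj2 supA)) : A s by split; lra.
  by rewrite leNgt sc.
have {cv}cv : processed x j (sup A) = v by apply/eqP; rewrite eq_le cv.
exists (sup A); split => //.
by rewrite lt_neqAle ac andbT; apply/eqP => ac'; rewrite -ac' in cv; lra.
Qed.

(** A job that overshot to [w] would pass the midpoint of [proc j] and [w], and be processed after
    that with negative remaining time, against [rate_gt0]. *)
Lemma remaining_ge0 j s : 0 <= s -> 0 <= remaining x j s.
Proof.
move=> s0; rewrite leNgt; apply/negP => rs.
pose w := processed x j s.
have pw : proc j < w by rewrite -subr_lt0.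
have [||c [c0 cs ec _]] := @first_passage j 0 s ((proc j + w) / 2) (lexx _) s0.
- by rewrite processed0; have := proc_gt0 j; lra.
- by rewrite -/w; lra.
have [|u /andP[cu us] /rate_gt0[_]] := @exists_rate_gt0 j c s (ltW c0) cs.
  by rewrite ec -/w; lra.
rewrite /remaining; have := processed_mono j (ltW c0) (ltW cu); lra.
Qed.

Lemma remaining_anti j a b : 0 <= a -> a <= b -> remaining x j b <= remaining x j a.
Proof. by move=> a0 ab; rewrite lerD2l lerN2 processed_mono. Qed.

Lemma remaining_le_proc j s : 0 <= s -> remaining x j s <= proc j.
Proof. by move=> s0; rewrite gerBl processed_ge0. Qed.

Lemma total_rate_integral s :
  mu.-integrable `[0, s]%classic (EFin \o (fun u => \sum_j x j u)) /\
  \sum_j processed x j s = (\int[mu]_(u in `[0, s]) \sum_j x j u)%R.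
Proof.
have fin := itv_finite true false 0 s.
elim: (index_enum _) => [|j r [int_r ih]].
  have -> : (fun u => \sum_(j <- [::]) x j u) = cst 0.
    by apply/funext => u; rewrite big_nil.
  rewrite big_nil Rintegral_cst// mul0r; split => //.
  exact: (@integrable0 _ _ _ mu).
have -> : (fun u => \sum_(i <- j :: r) x i u) = (fun u => x j u + \sum_(i <- r) x i u).
  by apply/funext => u; rewrite big_cons.
have int_j := rate_integrable j fin.
rewrite big_cons RintegralD// -ih; split => //.
exact: (integrableD _ int_j int_r).
Qed.

Lemma Rintegral1 s : 0 <= s -> (\int[mu]_(u in `[0, s]) 1)%R = s.
Proof.
move=> s0; rewrite Rintegral_cst//= lebesgue_measure_itv/= lte_fin.
by case: ltP => [_|ba]; rewrite /= mul1r ?subr0//; lra.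
Qed.

Lemma sum_processed_le s : 0 <= s -> \sum_j processed x j s <= s.
Proof.
move=> s0; rewrite (proj2 (total_rate_integral s)) -[leRHS]Rintegral1//.
apply: le_Rintegral => //.
- by have [] := total_rate_integral s.
- apply: measurable_bounded_integrable => //; first exact: itv_finite.
  by exists 1; split => // M M1 u _ /=; rewrite normr1 ltW.
- by move=> u _; exact: rate_sum_le1.
Qed.

Lemma sum_processed_busy s t : busy_until x t -> 0 <= s <= t ->
  \sum_j processed x j s = s.
Proof.
move=> busy /andP[s0 st].
rewrite (proj2 (total_rate_integral s)) -[RHS]Rintegral1// /Rintegral.
(* [busy_until] says nothing at [t] itself, so the endpoint [s], which may equal [t], is removed
   from the domain. *)
congr fine; rewrite -!integral_itv_bndo_bndc//; last first.
  apply: measurable_funS (measurable_int mu (proj1 (total_rate_integral s))) => //.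
  by apply: subset_itv; rewrite bnd_simp.
apply: ae_eq_integral => //.
  apply: measurable_funS (measurable_int mu (proj1 (total_rate_integral s))) => //.
  by apply: subset_itv; rewrite bnd_simp.
have F : Filter (nbhs (almost_everywhere mu)) by exact: ae_filter_ringOfSetsType.
apply: filterS busy => u /=; rewrite in_itv/= => bu /andP[u0 us].
by rewrite bu// u0 (lt_le_trans us).
Qed.

End Processing.
(** Closes the gap between [rate_gt0], which allows [release j = s], and [active], which asks for a
    strictly earlier release: the release times form a finite, hence null, set. *)
Lemma ae_not_released (R : realType) (I : instance R) :
  \forall s \ae (@lebesgue_measure R), forall j : job I, release j != s.
Proof.
exists (range (@release R I))%classic; split.
- exact/countable_measurable/finite_set_countable/finite_image/finite_finset.
- exact/countable_lebesgue_measure0/finite_set_countable/finite_image/finite_finset.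
- move=> s /= /existsNP[j /negP]; rewrite negbK => /eqP <-; exact: imageT.
Qed.

(* At time s < t, [x] has processed s units and still has work, so [y], having
   processed at most s units, has work as well. *)
Lemma busy_until_transfer (R : realType) (I : instance R) (x y : schedule I) (t : R) :
  busy_until x t -> no_unnecessary_idling y -> busy_until y t.
Proof.
move=> busy idle.
have F : Filter (nbhs (almost_everywhere (@lebesgue_measure R))).
  exact: ae_filter_ringOfSetsType.
have busy_ae := busy.
apply: filterS3 busy_ae idle (ae_not_released I) => s busy_s idle_s nrel.
move=> /andP[s0 st].
apply: idle_s; apply/negP => /eqP none.
have Ex : \sum_j processed x j s = s by rewrite (sum_processed_busy busy)// s0 ltW.
have Ey := sum_processed_le y s0.
have [j xj] : exists j, 0 < x j s.
  apply: contrapT => nox; have /eqP : \sum_j x j s = 1 by apply: busy_s; rewrite s0.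
  rewrite big1 ?(eq_sym 0) ?oner_eq0// => j _; apply/eqP.
  rewrite eq_le rate_ge0 andbT leNgt; apply/negP => xj; apply: nox; by exists j.
have [rj remj] := rate_gt0 xj.
suff : \sum_i processed x i s < \sum_i processed y i s by rewrite Ex; lra.
have le_xy i : processed x i s <= processed y i s.
  have [ri|ri] := ltP (release i) s; last by rewrite !processed_before_release.
  have : i \notin active y s by rewrite none inE.
  rewrite inE ri/= -leNgt.
  have := remaining_ge0 x i s0; rewrite /remaining; lra.
(* The job [j] makes the inequality strict: [x] still works on it, whereas [y] has completed it. *)
rewrite (bigD1 j)//= [ltRHS](bigD1 j)//= ltr_leD//; last by apply: ler_sum => i _.
have : j \notin active y s by rewrite none inE.
rewrite inE lt_neqAle nrel rj/= -leNgt; move: remj; rewrite /remaining; lra.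
Qed.

(** * Consequences of the SLF rule *)

Section SLF.
Variables (R : realType) (eps : R) (I : instance R) (slf : schedule I).
Hypotheses (heps : 0 < eps < 1) (hslf : is_slf eps slf).
Implicit Types (i j : job I) (s a b k : R).

Local Notation U := (unknown_set eps slf).

Let th_gt0 : 0 < eps / (1 - eps).
Proof. by have /andP[e0 e1] := heps; rewrite divr_gt0// subr_gt0. Qed.

Lemma knownE s j : known eps slf s j = ((1 - eps) * proc j <= processed slf j s).
Proof. rewrite /known /remaining; apply/idP/idP; lra. Qed.

Lemma known_mono a b j : 0 <= a -> a <= b ->
  known eps slf a j -> known eps slf b j.
Proof.
by move=> a0 ab; rewrite !knownE => /le_trans; apply; exact: processed_mono.
Qed.

Lemma unknown_setP s j : 0 <= s ->
  reflect (release j < s /\ ~~ known eps slf s j) (j \in U s).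
Proof.
move=> s0; rewrite !inE; apply: (iffP andP) => [[/andP[]]//|[rs nk]].
split => //; rewrite rs/=; move: nk; rewrite /known -ltNge; apply: le_lt_trans.
by have /andP[e0 _] := heps; rewrite mulr_ge0// ltW// proc_gt0.
Qed.

(** An unknown job has received less than [(1 - eps) * proc j], so its estimate is below
    [eps * proc j], which is below its remaining time. *)
Lemma estimate_le_remaining s j : estimate eps slf s j <= remaining slf j s.
Proof.
rewrite /estimate; case: ifPn => // /negP; rewrite knownE => /negP; rewrite -ltNge.
have /andP[e0 e1] := heps; rewrite mulrAC ler_pdivrMr ?subr_gt0// /remaining; nra.
Qed.

Lemma touched_min_estimate s i j : 0 <= s -> touched slf s j ->
  i \in active slf s -> estimate eps slf s j <= estimate eps slf s i.
Proof.
move=> s0 sj /[dup] ai; have [A [sA _ step]] := hslf s0.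
move=> /(fintype.subsetP sA) iA.
have A0 : A != finset.set0 by apply/set0Pn; exists i.
rewrite -lee_fin; move: (step A0); rewrite /slf_step.
set K := [set j in A | known _ _ _ _]; set V := [set j in A | ~~ known _ _ _ _].
have : i \in K \/ i \in V by rewrite !inE iA; case: known; [left|right].
have minK : i \in K -> (min_estimate eps slf s K <= (estimate eps slf s i)%:E)%E.
  exact: bigmin_le_cond.
have minV : i \in V -> (min_estimate eps slf s V <= (estimate eps slf s i)%:E)%E.
  exact: bigmin_le_cond.
case: ifPn => [KV iKV [k [_ ek rk]]|].
  have -> : j = k.
    by apply/eqP; move: sj; rewrite /touched rk; case: eqP => //=; rewrite ltxx.
  rewrite ek; case: iKV => [/minK//|/minV]; exact: le_trans.
rewrite -ltNge => VK iKV rates; move: sj; rewrite /touched rates.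
case: ifPn => [|_]; last by rewrite ltxx.
rewrite inE => /andP[_ /eqP->] _.
case: iKV => [/minK|/minV//]; exact/le_trans/ltW.
Qed.

(* A job that stops being unknown at k is being processed just before k, so it
   then has the smallest estimate. *)
Lemma succession t0 a k v : 0 <= t0 < k -> 0 <= a < k ->
  (1 <= #|U k :\: U t0|)%N ->
  (forall s, a <= s < k -> ~~ known eps slf s v) -> known eps slf k v ->
  exists2 u, u \in U k :\: U t0 & processed slf v k <= processed slf u k.
Proof.
move=> /andP[t00 t0k] /andP[a0 ak] /card_gt0P[u uU] nk kk.
exists u => //; rewrite leNgt; apply/negP => lt_uv.
have k0 : 0 <= k by lra.
have [ru nu] : release u < k /\ ~~ known eps slf k u.
  by apply/unknown_setP => //; move: uU; rewrite inE => /andP[].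
(* Within half the gap before [k], at speed at most 1, [v] is already ahead of [u]. Serving [v]
   there while [u] is released and unknown contradicts the rule. *)
pose b := Num.max (Num.max a (release u))
  (k - (processed slf v k - processed slf u k) / 2).
have bk : b < k by rewrite /b !gt_max ak ru/=; lra.
have ab : a <= b by rewrite /b !le_max lexx.
have rb : release u <= b by rewrite /b !le_max lexx orbT.
have hb : k - (processed slf v k - processed slf u k) / 2 <= b.
  by rewrite /b !le_max lexx orbT.
have b0 : 0 <= b := le_trans a0 ab.
have [|s /andP[bs sk] vs] := exists_rate_gt0 b0 (ltW bk) (j := v) (x := slf).
  move: kk (nk b); rewrite !knownE ab bk -ltNge => /[swap] /(_ isT); exact: lt_le_trans.
have s0 : 0 <= s by lra.
have ns : ~~ known eps slf s u by apply: contra nu; exact: known_mono (ltW sk).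
have us : u \in U s by apply/unknown_setP => //; split => //; exact: le_lt_trans bs.
have := touched_min_estimate s0 vs (_ : u \in active slf s).
have nv : ~~ known eps slf s v by apply: nk; rewrite sk ltW// (le_lt_trans ab).
move: us; rewrite inE => /andP[us _] /(_ us).
rewrite /estimate (negbTE nv) (negbTE ns) ler_pM2l//.
have := processed_lip slf v b0 (ltW bk).
have := processed_mono slf v b0 (ltW bs).
have := processed_mono slf u s0 (ltW sk); lra.
Qed.

Lemma becomes_known a b j : 0 <= a -> a <= b ->
  ~~ known eps slf a j -> known eps slf b j ->
  exists k, [/\ a < k, k <= b, processed slf j k = (1 - eps) * proc j &
     forall s, a <= s < k -> ~~ known eps slf s j].
Proof.
move=> a0 ab; rewrite !knownE -ltNge => na kb.
have [k [ak kb' ek nk]] := first_passage a0 ab na kb.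
by exists k; split => // s /nk; rewrite knownE -ltNge.
Qed.

(** Induction on the number of jobs, released or not, that are not known at [s]; arrivals cannot
    increase it. If [v] becomes known at [k], succession yields a new unknown job with at least as
    much processing, and [v] has left the count. *)
Lemma new_unknown_processed_le t0 t1 E s v :
  0 <= t0 -> t0 <= t1 ->
  (forall s, t0 < s <= t1 -> (1 <= #|U s :\: U t0|)%N) ->
  (forall j, j \in U t1 :\: U t0 -> processed slf j t1 <= E) ->
  t0 < s <= t1 -> v \in U s :\: U t0 ->
  processed slf v s <= E.
Proof.
move=> ht0 ht1 hnew hE.
have [n] := ubnP #|[set j | ~~ known eps slf s j]|; elim: n s v => // n IH s v.
rewrite ltnS => cardn /andP[t0s st1]; rewrite inE => /andP[vt0 vs].
have s0 : 0 <= s by lra.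
have [rv nv] := unknown_setP v s0 vs.
have [kv|nkv] := boolP (known eps slf t1 v); last first.
  apply: le_trans (processed_mono slf v s0 st1) (hE v _).
  rewrite inE vt0/=; apply/unknown_setP; first lra.
  by split => //; exact: lt_le_trans st1.
have [k [sk kt1 ek nk]] := becomes_known s0 st1 nv kv.
have kk : known eps slf k v by rewrite knownE ek.
have hk : t0 < k <= t1 by lra.
have h0 : 0 <= t0 < k by lra.
have hs : 0 <= s < k by lra.
have [u uk vu] := succession h0 hs (hnew _ hk) nk kk.
apply: le_trans (processed_mono slf v s0 (ltW sk)) _.
apply: le_trans vu _; apply: IH uk; last lra.
apply: leq_trans cardn; apply: proper_card; apply/properP; split.
  apply/fintype.subsetP => i; rewrite !inE; apply: contra; exact: known_mono (ltW sk).
by exists v; rewrite !inE ?nv// kk.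
Qed.

(** Such a job has received nothing at [t0]. When it becomes known it has received exactly
    [(1 - eps) * proc j], and some new unknown job has received no less. *)
Lemma new_known_proc_le t0 t1 E j :
  0 <= t0 -> t0 <= t1 ->
  (forall s, t0 < s <= t1 -> (1 <= #|U s :\: U t0|)%N) ->
  (forall j, j \in U t1 :\: U t0 -> processed slf j t1 <= E) ->
  t0 <= release j -> known eps slf t1 j ->
  (1 - eps) * proc j <= E.
Proof.
move=> ht0 ht1 hnew hE.
move=> rj kj.
have nj : ~~ known eps slf t0 j.
  rewrite knownE processed_before_release// -ltNge mulr_gt0 ?proc_gt0//.
  by have /andP[_ e1] := heps; rewrite subr_gt0.
have [k [t0k kt1 ek nk]] := becomes_known ht0 ht1 nj kj.
have kk : known eps slf k j by rewrite knownE ek.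
have hk : t0 < k <= t1 by lra.
have h0 : 0 <= t0 < k by lra.
have [u uk ju] := succession h0 h0 (hnew _ hk) nk kk.
rewrite -ek; apply: le_trans ju _.
apply: (new_unknown_processed_le ht0 ht1 hnew hE _ uk); lra.
Qed.

(** Whenever [j] is served, some new unknown job has an estimate of at most [eps / (1 - eps) * E],
    and the rule would prefer it to a known job with larger remaining time. *)
Lemma processed_known_remaining_le t0 t1 E j :
  0 <= t0 -> t0 <= t1 ->
  (forall s, t0 < s <= t1 -> (1 <= #|U s :\: U t0|)%N) ->
  (forall j, j \in U t1 :\: U t0 -> processed slf j t1 <= E) ->
  known eps slf t0 j ->
  remaining slf j t1 < remaining slf j t0 ->
  remaining slf j t0 <= eps / (1 - eps) * E.
Proof.
move=> ht0 ht1 hnew hE.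
move=> kj lt_r; rewrite leNgt; apply/negP => big.
have lt_p : processed slf j t0 < processed slf j t1.
  by move: lt_r; rewrite /remaining; lra.
(* Until [w] is reached, at most half of the excess over the threshold is consumed, so the remaining
   time of [j] stays above it. *)
pose w := Num.min (processed slf j t1)
  (processed slf j t0 + (remaining slf j t0 - eps / (1 - eps) * E) / 2).
have t0w : processed slf j t0 < w by rewrite /w lt_min lt_p/=; lra.
have wt1 : w <= processed slf j t1 by rewrite /w ge_min lexx.
have hw : w <= processed slf j t0 + (remaining slf j t0 - eps / (1 - eps) * E) / 2.
  by rewrite /w ge_min lexx orbT.
have [c [t0c ct1 ec lt_c]] := first_passage ht0 ht1 t0w wt1.
have [|s /andP[t0s sc] js] := exists_rate_gt0 ht0 (ltW t0c) (j := j) (x := slf).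
  by rewrite ec.
have s0 : 0 <= s by lra.
have /card_gt0P[u uU] : (1 <= #|U s :\: U t0|)%N by apply: hnew; lra.
have uE : processed slf u s <= E.
  by apply: (new_unknown_processed_le ht0 ht1 hnew hE _ uU); lra.
move: uU; rewrite !inE => /andP[_ /andP[us nu]].
have := touched_min_estimate s0 js (_ : u \in active slf s).
rewrite inE => /(_ us); rewrite /estimate (known_mono ht0 (ltW t0s) kj) (negbTE nu).
have : eps / (1 - eps) * processed slf u s <= eps / (1 - eps) * E by rewrite ler_pM2l.
have := lt_c s; rewrite (ltW t0s) sc => /(_ isT).
move: hw; rewrite /remaining; lra.
Qed.

Lemma touched_unknown_remaining_ge s i j : 0 <= s -> touched slf s j ->
  j \in U s -> i \in active slf s ->
  eps / (1 - eps) * processed slf j s <= remaining slf i s.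
Proof.
move=> s0 js /(unknown_setP _ s0)[_ nj] ai.
apply: le_trans (estimate_le_remaining s i).
by have := touched_min_estimate s0 js ai; rewrite {1}/estimate (negbTE nj).
Qed.

End SLF.

(** * Sums over largest elements, and volumes of active sets *)

Lemma sum_le_top (R : realType) (T : finType) (f : T -> R) (A P Q : {set T}) :
  P \subset A -> (#|P| <= #|Q|)%N -> (forall i, i \in Q -> 0 <= f i) ->
  (forall i j, i \in Q -> j \in A :\: Q -> f j <= f i) ->
  \sum_(i in P) f i <= \sum_(i in Q) f i.
Proof.
move=> PA cardPQ f0 top.
rewrite (big_setID Q)/= [leRHS](big_setID P)/= finset.setIC lerD2l.
have {cardPQ} : (#|P :\: Q| <= #|Q :\: P|)%N.
  by rewrite -(leq_add2l #|P :&: Q|) cardsID {1}finset.setIC cardsID.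
have [->|] := set_0Vmem (Q :\: P).
  by rewrite cards0 leqn0 cards_eq0 => /eqP->; rewrite !big_set0.
(* The minimum [f i] over [Q :\: P] bounds every value on [P :\: Q] from above; being nonnegative,
   it absorbs the difference of cardinalities. *)
move=> [i0 i0QP] cardPQ; case: (@arg_minP _ _ _ i0 (mem (Q :\: P)) f i0QP) => i iQP fi.
have {}iQP : i \in Q :\: P := iQP.
have iQ : i \in Q by move: iQP; rewrite inE => /andP[].
apply: (@le_trans _ _ (\sum_(j in Q :\: P) f i)); last exact: ler_sum.
apply: (@le_trans _ _ (\sum_(j in P :\: Q) f i)).
  apply: ler_sum => j; rewrite inE => /andP[jQ jP]; apply: top => //.
  by rewrite inE jQ (fintype.subsetP PA).
by rewrite !sumr_const ler_wpMn2l// f0.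
Qed.

Lemma vol_active (R : realType) (I : instance R) (x : schedule I) (s : R) : 0 <= s ->
  vol x (active x s) s = \sum_(j | release j < s) remaining x j s.
Proof.
move=> s0; rewrite /vol big_mkcond [RHS]big_mkcond/=; apply: eq_bigr => j _.
rewrite inE; case: (release j < s) => //=; case: ltP => // r0.
by apply/eqP; rewrite eq_le r0 remaining_ge0.
Qed.

(** Both schedules have done exactly [s] units of work, none of it on unreleased jobs, so the work
    left on released jobs does not depend on the schedule. *)
Lemma vol_active_eq (R : realType) (I : instance R) (x y : schedule I) (s t : R) :
  0 <= s <= t -> busy_until x t -> busy_until y t ->
  vol x (active x s) s = vol y (active y s) s.
Proof.
move=> s0t busx busy; have /andP[s0 _] := s0t; rewrite !vol_active//.
have vol_released (z : schedule I) : busy_until z t ->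
    \sum_(j | release j < s) remaining z j s =
    \sum_(j : job I) proc j - s - \sum_(j : job I | ~~ (release j < s)) proc j.
  move=> busz; have -> : \sum_(j : job I) proc j - s = \sum_j remaining z j s.
    by rewrite /remaining sumrB (sum_processed_busy busz s0t).
  rewrite [in RHS](bigID (fun j => release j < s))/= -addrA -sumrB.
  rewrite [X in _ + X]big1 ?addr0// => j.
  by rewrite -leNgt => sj; rewrite /remaining processed_before_release// subr0 subrr.
by rewrite !vol_released.
Qed.

Lemma vol_le (R : realType) (I : instance R) (x : schedule I) (s : R)
  (P Q : {set job I}) : 0 <= s -> P \subset Q -> vol x P s <= vol x Q s.
Proof.
move=> s0 PQ; rewrite /vol [leRHS](big_setID P)/= (finset.setIidPr PQ) lerDl.
by apply: sumr_ge0 => j _; exact: remaining_ge0.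
Qed.

Lemma active_anti (R : realType) (I : instance R) (x : schedule I) (a b : R) j :
  0 <= a -> a <= b -> release j < a -> j \in active x b -> j \in active x a.
Proof.
move=> a0 ab ja; rewrite !inE ja/= => /andP[_] /lt_le_trans; apply.
exact: remaining_anti.
Qed.

(** * Accounting of the excess over [th] between [t0] and [t1] *)

Theorem lemma3p6 (R : realType) (eps : R) (heps : 0 < eps < 1)
  (I : instance R) (slf opt : schedule I) (t : R)
  (hslf : is_slf eps slf) (hopt : optimal opt)
  (hbusy : busy_until slf t)
  (hidle_slf : no_unnecessary_idling slf)
  (hidle_opt : no_unnecessary_idling opt)
  (B : R -> {set job I})
  (hB : forall s : R, 0 <= s <= t -> is_B eps slf opt t s (B s))
  (t0 : R) (ht0 : 0 <= t0 <= t)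
  (hvol0 : vol opt (opt_alive opt t t0) t0 <= vol slf (B t0) t0)
  (hfrozen0 : unknown_set eps slf t0 = frozen_set eps slf t t0)
  (t1 : R) (ht1 : t0 <= t1 <= t)
  (L : job I) (hleader : is_leader eps slf t t1 L) (htouched : touched slf t1 L)
  (hfrozen : forall t' : R, t0 <= t' <= t1 ->
     frozen_set eps slf t t0 = frozen_set eps slf t t')
  (hnew : forall s : R, t0 < s <= t1 ->
     (1 <= #|unknown_set eps slf s :\: unknown_set eps slf t0|)%N) :
  vol opt (opt_alive opt t t1) t1 <= vol slf (B t1) t1.
Proof.
have /andP[t00 t0t] := ht0; have /andP[t01 t1t] := ht1; have /andP[e0 e1] := heps.
have t10 : 0 <= t1 := le_trans t00 t01.
pose S := active slf t1; pose O := opt_alive opt t t0.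
pose c := `|Num.ceil (1 / eps)|%N; pose N := opt_alive opt t t1 :\: O.
have t1B : 0 <= t1 <= t by rewrite t10.
have [] := hB t1 t1B; rewrite -/c -/S => B1S cardB1 topB1.
have [] := hB t0 ht0; rewrite -/c -/O => B0S cardB0 _.
have OS : O \subset opt_alive opt t t1.
  apply/fintype.subsetP => j; rewrite /O !inE => /andP[/andP[-> rt] /andP[jt0 _]].
  by rewrite rt (lt_le_trans jt0)//= (lt_le_trans rt)// remaining_anti.
have [small|large] := leqP #|S| (c * #|opt_alive opt t t1|).
  have -> : B t1 = S.
    by apply/eqP; rewrite eqEcard B1S cardB1 (minn_idPr small)/=.
  rewrite (@vol_active_eq _ _ slf opt t1 t)//; last exact: busy_until_transfer hbusy _.
  by apply: vol_le => //; exact: subsetIr.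
have {}cardB1 : #|B t1| = (c * #|opt_alive opt t t1|)%N.
  by rewrite cardB1; apply/minn_idPl/ltnW.
have cardO : #|opt_alive opt t t1| = (#|O| + #|N|)%N.
  by rewrite -(cardsID O) (finset.setIidPr OS).
have [c1 ceps] : 1 <= c%:R :> R /\ 1 / eps <= c%:R.
  have ceps : 1 / eps <= c%:R.
    have /ltW ieps0 : 0 < 1 / eps by rewrite divr_gt0.
    by rewrite /c natr_absz ger0_norm ?ceil_ge// ceil_ge0 (lt_le_trans (ltrN10 _)).
  by split => //; apply: le_trans ceps; rewrite ler_pdivlMr// mul1r ltW.
pose E := processed slf L t1; pose th := eps / (1 - eps) * E.
have [LU Lmax] := hleader.
have frozen1 : frozen_set eps slf t t1 = unknown_set eps slf t0.
  by rewrite hfrozen0 (hfrozen t1)// t01 lexx.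
(* The leader now dominates all new unknown jobs at [t1], which is the bound [E] required by the
   lemmas on SLF. *)
rewrite frozen1 in LU Lmax.
have E0 : 0 <= E by exact: processed_ge0.
have th0 : 0 <= th by rewrite mulr_ge0// divr_ge0// ?subr_ge0 ltW.
have thE : (1 - eps) * th = eps * E.
  by rewrite /th mulrA mulrCA divff ?mulr1// subr_eq0 gt_eqF.
have S_ge_th j : j \in S -> th <= remaining slf j t1.
  apply: touched_unknown_remaining_ge => //.
  by move: LU; rewrite inE => /andP[].
have old j : j \in active slf t0 ->
    remaining slf j t1 = remaining slf j t0 \/ remaining slf j t0 <= th.
  move=> jt0; have [kj|nkj] := boolP (known eps slf t0 j).
    have := remaining_anti slf j t00 t01; rewrite le_eqVlt.
    move=> /predU1P[->|]; first by left.
    by right; apply: (processed_known_remaining_le heps hslf t00 t01 hnew Lmax).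
  (* Jobs unknown at [t0] are frozen, hence receive nothing up to [t1]. *)
  have : j \in unknown_set eps slf t0 by rewrite inE jt0.
  rewrite hfrozen0 inE => /andP[_ /asboolP fz]; left.
  rewrite /remaining (@processed_const _ _ slf j t0 t1)// => s /andP[t0s st1].
  apply/eqP; rewrite eq_le rate_ge0 andbT leNgt; apply/negP; apply: fz.
  by rewrite ltW//= (le_trans (ltW st1)).
have Nrel j : j \in N -> t0 <= release j < t1.
  rewrite /N /O /opt_alive !finset.in_setD !finset.in_setI negb_and => /andP[].
  move=> /orP[/negbTE->//|jt0] /andP[_ jt1]; apply/andP; split; last first.
    by move: jt1; rewrite inE => /andP[].
  by rewrite leNgt; apply: contra jt0 => jlt; exact: active_anti jt1.
(* [E + th] equals both [th / eps] and [E / (1 - eps)]: the first form is paid by [c], the second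
   bounds new known jobs. *)
have cth : E + th <= c%:R * th.
  have -> : E + th = 1 / eps * th.
    by apply: (mulfI (lt0r_neq0 e0)); rewrite div1r mulrDr -thE mulVKf ?gt_eqF//; ring.
  exact: ler_wpM2r.
have proc_th j : j \in N -> known eps slf t1 j -> proc j <= c%:R * th.
  move=> jN kj; have /andP[jt0 _] := Nrel j jN; apply: le_trans cth.
  have jE := new_known_proc_le heps hslf t00 t01 hnew Lmax jt0 kj.
  have e1' : 0 < 1 - eps by rewrite subr_gt0.
  by rewrite -(ler_pM2l e1') mulrDr thE -mulrDl subrK mul1r.
have newS j : j \in N -> j \in S -> proc j <= c%:R * th + (remaining slf j t1 - th).
  move=> jN jS; have [kj|nkj] := boolP (known eps slf t1 j).
    by apply: le_trans (proc_th j jN kj) _; rewrite lerDl subr_ge0 S_ge_th.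
  (* For an unknown job, [proc j] splits into processing at most [E] and its remaining time. *)
  have : processed slf j t1 <= E.
    apply: Lmax; rewrite inE; apply/andP; split; last by rewrite inE jS.
    rewrite !inE; have /andP[jt0 _] := Nrel j jN.
    by rewrite negb_and negb_and -leNgt jt0.
  by move: cth; rewrite /remaining; lra.
have newC j : j \in N -> j \notin S -> proc j <= c%:R * th.
  move=> jN jS; apply: proc_th => //; have /andP[_ jt1] := Nrel j jN.
  apply: contraNT jS => nkj.
  suff : j \in unknown_set eps slf t1 by rewrite inE => /andP[].
  by apply/unknown_setP.
have alive_le :
    vol opt (opt_alive opt t t1) t1 <= vol slf (B t0) t0 + \sum_(j in N) proc j.
  rewrite {1}/vol (big_setID O)/= (finset.setIidPr OS) lerD//.
    apply: le_trans hvol0; apply: ler_sum => j _; exact: remaining_anti.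
  by apply: ler_sum => j _; exact: remaining_le_proc.
apply: le_trans alive_le _.
have sumN : \sum_(j in N) proc j <=
    (c * #|N|)%:R * th + \sum_(j in N :&: S) (remaining slf j t1 - th).
  have -> : (c * #|N|)%:R * th = \sum_(j in N) (c%:R * th).
    by rewrite sumr_const -[RHS]mulr_natl natrM; ring.
  rewrite (big_setID S) [X in _ <= X + _](big_setID S)/= addrAC -big_split/=.
  apply: lerD; apply: ler_sum => j; rewrite inE => /andP[jN jS]; first exact: newS.
  exact: newC.
have sumB0 : vol slf (B t0) t0 <=
    (c * #|O|)%:R * th + \sum_(j in B t0 :&: S) (remaining slf j t1 - th).
  rewrite -lerBlDl; apply: (@le_trans _ _ (\sum_(j in B t0) (remaining slf j t0 - th))).
    rewrite sumrB lerD2l lerN2 sumr_const -[X in X <= _]mulr_natl.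
    rewrite ler_wpM2r// ler_nat cardB0.
    exact: geq_minl.
  rewrite (big_setID S)/= -[leRHS]addr0; apply: lerD.
    apply: ler_sum => j; rewrite inE => /andP[jB jS]; rewrite lerD2r.
    have [->//|] := old j (fintype.subsetP B0S j jB).
    by move=> /le_trans; apply; exact: S_ge_th.
  (* A job of [B t0] gone by [t1] has changed its remaining time, so it was at most [th] at [t0]. *)
  apply: sumr_le0 => j; rewrite inE => /andP[jS jB]; rewrite subr_le0.
  have jt0 := fintype.subsetP B0S j jB; have [req|//] := old j jt0.
  move: jt0 jS; rewrite !inE -req => /andP[jt0 ->].
  by rewrite (lt_le_trans jt0 t01).
have disj : [disjoint B t0 :&: S & N :&: S].
  rewrite -setI_eq0; apply/eqP/setP => j; rewrite !finset.in_setI finset.in_set0.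
  apply/negP.
  move=> /andP[/andP[/(fintype.subsetP B0S)]].
  rewrite inE => /andP[jt0 _] _ /andP[/Nrel /andP[t0j _] _].
  by have := lt_le_trans jt0 t0j; rewrite ltxx.
have excess : \sum_(j in (B t0 :&: S) :|: (N :&: S)) (remaining slf j t1 - th) <=
    \sum_(j in B t1) (remaining slf j t1 - th).
  apply: (@sum_le_top _ _ _ S).
  (* The union has at most [c * #|O| + #|N|] jobs, which fits into [#|B t1|] because [c] is at least
     1. *)
  - by rewrite finset.subUset !subsetIr.
  - rewrite (leq_trans (leq_card_setU _ _))// cardB1 cardO mulnDr leq_add//.
      apply: leq_trans (subset_leq_card (subsetIl _ _)) _.
      by rewrite cardB0 geq_minl.
    apply: leq_trans (subset_leq_card (subsetIl _ _)) _.
    by rewrite leq_pmull// -(ler_nat R).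
  - by move=> j jB; rewrite subr_ge0 S_ge_th// (fintype.subsetP B1S).
  - by move=> i j iB jS; rewrite lerD2r topB1.
have : vol slf (B t1) t1 = (c * #|opt_alive opt t t1|)%:R * th +
    \sum_(j in B t1) (remaining slf j t1 - th).
  by rewrite sumrB sumr_const cardB1 -[in X in _ - X]mulr_natl addrC subrK.
move: excess; have -> : \sum_(j in (B t0 :&: S) :|: (N :&: S)) (remaining slf j t1 - th) =
    \sum_(j in B t0 :&: S) (remaining slf j t1 - th) +
    \sum_(j in N :&: S) (remaining slf j t1 - th).
  by rewrite -bigU//; apply: eq_bigl => j; rewrite !inE.
rewrite cardO mulnDr natrD; lra.
Qed.
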